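(* Let $q\in\widetilde{\mathbb C}$ and $a\in\mathbb C$ with $a\neq0$ and $a\neq-q^{-n}$ for all $n\ge0$. Let $u$ be the symmetrical form such that $\sigma u=\mathcal A(a,q)$. Then $u$ is $H_{\sqrt q}$-semiclassical of class one and satisfies $$H_{\sqrt q}(x^3u)-(aq)^{-1}(\sqrt q-1)^{-1}\big((1+aq)x^2-1\big)u=0 .$$ Its recurrence coefficients are, for $n\ge0$, $$\gamma_{2n+1}=q^n\frac{1+aq^n}{(1+aq^{2n})(1+aq^{2n+1})},\qquad \gamma_{2n+2}=aq^{2n+1}\frac{1-q^{n+1}}{(1+aq^{2n+1})(1+aq^{2n+2})} .$$
   Context: $\mathcal P$ is the vector space of polynomials in one variable with complex coefficients and $\mathcal P'$ its dual; elements of $\mathcal P'$ are called forms; $\langle u,f\rangle$ is the action of $u$ on $f$ and $(u)_n=\langle u,x^n\rangle$ are the moments. All regular forms are normalized by $(u)_0=1$. A form is symmetrical if $(u)_{2n+1}=0$ for all $n\ge0$. Let $\widetilde{\mathbb C}=\{z\in\mathbb C: z\neq0,\ z^n\neq1\ \forall n\ge1\}$; $\sqrt{\cdot}$ is the principal square root. For a polynomial $g$, $\langle gu,f\rangle=\langle u,gf\rangle$. For $r\in\widetilde{\mathbb C}$, $(H_rf)(x)=\frac{f(rx)-f(x)}{(r-1)x}$ and $\langle H_ru,f\rangle=-\langle u,H_rf\rangle$. The form $\sigma u$ is defined by $\langle\sigma u,f\rangle=\langle u,f(x^2)\rangle$. A form $u$ is regular if there is a sequence of monic polynomials $\{B_n\}_{n\ge0}$,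 $\deg B_n=n$, with $\langle u,B_mB_n\rangle=r_n\delta_{n,m}$, $r_n\ne0$; then $B_0=1$, $B_1=x-\beta_0$, $B_{n+2}=(x-\beta_{n+1})B_{n+1}-\gamma_{n+1}B_n$ with $\gamma_{n+1}\neq0$, $n\ge0$ (for symmetrical $u$ all $\beta_n=0$); the $\gamma_{n+1}$ are the recurrence coefficients. A form $u$ is $H_r$-semiclassical if it is regular and $H_r(\Phi u)+\Psi u=0$ for some polynomials $\Phi$ (monic, degree $t\ge0$) and $\Psi$ (degree $p\ge1$). It is of class $s=\max(p-1,t-2)$ if the pair $(\Phi,\Psi)$ satisfies $$\prod_{c\in\mathcal Z_\Phi}\Big\{\big|r\Psi(rc)+(H_r\Phi)(c)\big|+\big|\langle u,\ r(\theta_{cr}\Psi)+\theta_{cr}(\theta_c\Phi)\rangle\big|\Big\}>0,$$ where $\mathcal Z_\Phi$ is the set of zeros of $\Phi$ and $(\theta_cf)(x)=\frac{f(x)-f(c)}{x-c}$. $\mathcal A(a,q)$ (the Alternative $q$-Charlier form) is the form with $(\mathcal A(a,q))_0=1$ satisfying $H_q(x^2\mathcal A(a,q))-(aq)^{-1}(q-1)^{-1}\big((1+aq)x-1\big)\mathcal A(a,q)=0$. *)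

(* Defs.v *)
From HB Require Import structures.
From mathcomp Require Import all_boot all_order all_algebra.
From mathcomp Require Import classical_sets fsbigop reals.
From mathcomp Require Import complex.

Set Implicit Arguments.
Unset Strict Implicit.
Unset Printing Implicit Defensive.

Import Order.TTheory GRing.Theory Num.Theory.
Local Open Scope ring_scope.

(* Forms, i.e. elements of the algebraic dual of the complex polynomials, are
   the linear functionals {scalar {poly R[i]}}. *)
Notation pform R := {scalar {poly R[i]}}.

Section Forms.
Variable R : realType.
Notation C := R[i].
Implicit Types (u : pform R) (f g Phi Psi : {poly C}) (r q a c : C).

Definition nonroot_of_unity (z : C) : Prop :=
  z != 0 /\ forall n : nat, (0 < n)%N -> z ^+ n != 1.

Definition moment u (n : nat) : C := u 'X^n.

Definition symmetrical u : Prop := forall n, moment u n.*2.+1 = 0.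

(* f(rx) - f(x) is a multiple of x, so for r != 1 the division is exact. *)
Definition Hpoly r f : {poly C} := (f \Po (r *: 'X) - f) %/ ((r - 1) *: 'X).

(* The division is exact. *)
Definition theta c f : {poly C} := (f - f.[c]%:P) %/ ('X - c%:P).

Fact Hpoly_is_linear r : linear (Hpoly r).
Proof.
move=> k f g; rewrite /Hpoly linearP /= opprD addrACA -scalerBr.
by rewrite divpD divpZl.
Qed.
HB.instance Definition _ r :=
  GRing.isLinear.Build C {poly C} {poly C} *:%R (Hpoly r) (Hpoly_is_linear r).

Definition mul_form g u : {poly C} -> C := fun f => u (g * f).

Fact mul_form_is_scalar g u : scalar (mul_form g u).
Proof. by move=> k f h; rewrite /mul_form mulrDr -scalerAr linearP. Qed.
HB.instance Definition _ g u :=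
  GRing.isLinear.Build C {poly C} C *%R (mul_form g u) (mul_form_is_scalar g u).

Definition Hform r u : {poly C} -> C := fun f => - u (Hpoly r f).

Fact Hform_is_scalar r u : scalar (Hform r u).
Proof. by move=> k f h; rewrite /Hform Hpoly_is_linear linearP opprD mulrN. Qed.
HB.instance Definition _ r u :=
  GRing.isLinear.Build C {poly C} C *%R (Hform r u) (Hform_is_scalar r u).

Definition sigma u : {poly C} -> C := fun f => u (f \Po 'X^2).

Fact sigma_is_scalar u : scalar (sigma u).
Proof. by move=> k f h; rewrite /sigma !linearP. Qed.
HB.instance Definition _ u :=
  GRing.isLinear.Build C {poly C} C *%R (sigma u) (sigma_is_scalar u).

Definition orthogonal_seq u (B : nat -> {poly C}) : Prop :=
  [/\ forall n, B n \is monic,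
      forall n, size (B n) = n.+1
    & exists2 k : nat -> C, forall n, k n != 0 &
        forall m n, u (B m * B n) = k n * (n == m)%:R].

Definition regular u : Prop := exists B, orthogonal_seq u B.

(* gamma is indexed as in gamma_1, gamma_2, ...; gamma 0 is irrelevant. *)
Definition recurrence_coefficients u (beta gamma : nat -> C) : Prop :=
  (forall n, gamma n.+1 != 0) /\
  exists B : nat -> {poly C},
    [/\ orthogonal_seq u B, B 0%N = 1, B 1%N = 'X - (beta 0%N)%:P
      & forall n,
          B n.+2 = ('X - (beta n.+1)%:P) * B n.+1 - gamma n.+1 *: B n].

Definition pearson r u Phi Psi : Prop :=
  forall f, Hform r (mul_form Phi u) f + mul_form Psi u f = 0.

(* size f = deg f + 1, so the condition on Psi is deg Psi >= 1. *)
Definition semiclassical_pair r u Phi Psi : Prop :=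
  [/\ Phi \is monic, (2 <= size Psi)%N & pearson r u Phi Psi].

(* As Phi is monic, its set of zeros is finite, so that the product below is a
   genuine one.  Its value is a complex number with zero imaginary part. *)
Definition class_criterion r u Phi Psi : Prop :=
  0 < \big[*%R/1]_(c \in [set z : C | root Phi z]%classic)
        (`|r * Psi.[r * c] + (Hpoly r Phi).[c]|
         + `|u (r *: theta (c * r) Psi + theta (c * r) (theta c Phi))|).

(* The truncated subtraction t - 2 is harmless since p - 1 >= 0. *)
Definition semiclassical_of_class r u (s : nat) : Prop :=
  regular u /\ exists Phi Psi,
    [/\ semiclassical_pair r u Phi Psi, class_criterion r u Phi Psi
      & let t := (size Phi).-1 in let p := (size Psi).-1 in
        s = maxn (p - 1) (t - 2)].

(* Evaluating the equation at 'X^n gives (1 + a q^(n+1)) (u)_(n+1) = (u)_n,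
   so when a and all 1 + a q^(n+1) are nonzero exactly one form satisfies
   this. *)
Definition alternative_q_charlier a q u : Prop :=
  moment u 0 = 1 /\
  pearson q u 'X^2
    (- ((a * q)^-1 * (q - 1)^-1 *: ((1 + a * q) *: 'X - 1))).

(* The principal square root; sqrtC of numClosedFieldType is another branch,
   with values of nonnegative imaginary part. *)
Definition principal_sqrt (z : C) : C := sqrtc z.

End Forms.

(* Main.v *)
Require Import Defs.
From HB Require Import structures.
From mathcomp Require Import all_boot all_order all_algebra.
From mathcomp Require Import classical_sets fsbigop reals.
From mathcomp Require Import complex.
From mathcomp Require Import ring.

Set Implicit Arguments.
Unset Strict Implicit.
Unset Printing Implicit Defensive.

Import Order.TTheory GRing.Theory Num.Theory.
Local Open Scope ring_scope.

(** The whole argument takes place on moments.  Tested on powers of X, the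
    equation of the theorem for A with w = a q says exactly
    (1 + w q^n) (A)_(n+1) = (A)_n, and the equation for u over r = sqrt q says
    exactly (1 + w r^n) (u)_(n+2) = (u)_n ([pearson_moments]).  For odd n the
    latter holds by symmetry; for n = 2j it is the former, because r^(2j) = q^j
    and (u)_(2j) = (A)_j.  The class is read off at 0, the only zero of X^3
    ([semiclassical_X3]).

    For the recurrence coefficients, let B_n be generated by the announced
    gamma.  What has to be shown is that <u, X^m B_n> vanishes for m < n and
    not for m = n ([orthogonal_seq_Xn]).  These numbers have a closed form,
    found as follows.  Write B_(2n) as P_n(X^2).  Since
    (A)_(j+k) = (A)_j / prod_(1 <= i <= k) (1 + a q^(j+i)), the value
    <A, X^j P_n> is (A)_(j+n) times a polynomial of degree at most n in q^j,
    and orthogonality forces its zeros to be 1, q, ..., q^(n-1).  Hence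
    <u, X^(2j) B_(2n)> is a constant times
    prod_(i < n) (q^j - q^i) * (u)_(2(n+j)), and the odd case is similar.
    [u_Xn_closed_form] verifies this guess by induction along the three-term
    recurrence; the required zeros and non-zeros are then visible in the
    product. *)

(** * Forms and their moments *)

Lemma formZ (R : realType) (u : pform R) c f : u (c *: f) = c * u f.
Proof. exact: linearZ. Qed.

Lemma formB (R : realType) (u : pform R) f g : u (f - g) = u f - u g.
Proof. exact: linearB. Qed.

Lemma Hpoly_Xn (R : realType) (r : R[i]) n : r != 1 ->
  'X * Hpoly r 'X^n = ((r ^+ n - 1) / (r - 1)) *: 'X^n.
Proof.
rewrite -subr_eq0 => r1.
rewrite /Hpoly comp_Xn_poly exprZn -{2}['X^n]scale1r -scalerBl.
case: n => [|n]; first by rewrite !expr0 subrr mul0r !scale0r div0p mulr0.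
have -> : (r ^+ n.+1 - 1) *: 'X^(n.+1)
    = (((r ^+ n.+1 - 1) / (r - 1)) *: 'X^n) * ((r - 1) *: 'X).
  by rewrite -scalerAl -scalerAr scalerA divfK // -exprSr.
rewrite mulpK; first by rewrite -scalerAr -exprS.
by rewrite scaler_eq0 negb_or r1 polyX_eq0.
Qed.

(** With w = a q, the cases t = 1 and t = 2 are the polynomials Psi of the
    equations satisfied by the Alternative q-Charlier form and by its
    symmetrization. *)
Definition charlier_psi (R : realType) (r w : R[i]) t : {poly R[i]} :=
  - (w^-1 * (r - 1)^-1 *: ((1 + w) *: 'X^t - 1)).

(** Both sides of the equation are linear in the test polynomial, so it may be
    tested on powers of X, where multiplication by w (r - 1) clears the
    denominators. *)
Lemma pearson_moments (R : realType) (r w : R[i]) (u : pform R) t :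
    w != 0 -> r != 1 ->
  pearson r u 'X^(t.+1) (charlier_psi r w t) <->
  forall n, (1 + w * r ^+ n) * moment u (n + t) = moment u n.
Proof.
move=> w0 r1; have r1' : r - 1 != 0 by rewrite subr_eq0.
have E n : Hform r (mul_form 'X^(t.+1) u) 'X^n
    + mul_form (charlier_psi r w t) u 'X^n
    = w^-1 * (r - 1)^-1 * (moment u n - (1 + w * r ^+ n) * moment u (n + t)).
  rewrite /Hform /= /mul_form exprSr -mulrA Hpoly_Xn // -scalerAr formZ.
  have -> : charlier_psi r w t * 'X^n =
      (w^-1 * (r - 1)^-1) *: ('X^n - (1 + w) *: 'X^(n + t)).
    rewrite /charlier_psi -scalerN opprB -scalerAl mulrBl mul1r -scalerAl.
    by rewrite -exprD (addnC t n).
  rewrite formZ formB formZ -exprD /moment (addnC t n).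
  by field; rewrite w0 r1'.
split=> [P n|M f].
  have /eqP := E n; rewrite P eq_sym mulf_eq0 mulf_eq0 !invr_eq0.
  by rewrite (negbTE w0) (negbTE r1') /= subr_eq0 => /eqP.
rewrite -[f]coefK poly_def !linear_sum /= -big_split big1 // => i _.
by rewrite !linearZ /= -mulrDr E M subrr !mulr0.
Qed.

(** * Orthogonality of sequences given by a three-term recurrence *)

Fixpoint monic_rec (R : realType) (gamma : nat -> R[i]) n : {poly R[i]} :=
  match n with
  | 0 => 1
  | m.+1 => if m is l.+1
            then 'X * monic_rec gamma m - gamma m *: monic_rec gamma l
            else 'X
  end.

Lemma monic_recSS (R : realType) (gamma : nat -> R[i]) n :
  monic_rec gamma n.+2 =
    'X * monic_rec gamma n.+1 - gamma n.+1 *: monic_rec gamma n.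
Proof. by []. Qed.

Lemma monic_rec_size (R : realType) (gamma : nat -> R[i]) n :
  monic_rec gamma n \is monic /\ size (monic_rec gamma n) = n.+1.
Proof.
suff [] : (monic_rec gamma n \is monic /\ size (monic_rec gamma n) = n.+1) /\
  (monic_rec gamma n.+1 \is monic /\ size (monic_rec gamma n.+1) = n.+2) by [].
elim: n => [|n [[IHm IHs] [IHm1 IHs1]]].
  by rewrite /= monic1 size_poly1 monicX size_polyX.
split=> //.
have sX : size ('X * monic_rec gamma n.+1) = n.+3.
  by rewrite mulrC size_mulX ?IHs1 // monic_neq0.
have lt : (size (- (gamma n.+1 *: monic_rec gamma n))%R
            < size ('X * monic_rec gamma n.+1)%R)%N.
  rewrite sX size_polyN (leq_ltn_trans (size_scale_leq _ _)) //.
  by rewrite IHs ltnW.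
rewrite monic_recSS size_polyDl // sX; split=> //.
by rewrite monicE lead_coefDl // lead_coefM lead_coefX mul1r -monicE.
Qed.

(** B_k annihilates every polynomial of degree less than k.  For m <> n this
    applies to the factor of smaller degree, and for m = n to B_n - X^n. *)
Lemma orthogonal_seq_Xn (R : realType) (u : pform R) (B : nat -> {poly R[i]}) :
    (forall n, B n \is monic) -> (forall n, size (B n) = n.+1) ->
    (forall n m, (m < n)%N -> u ('X^m * B n) = 0) ->
    (forall n, u ('X^n * B n) != 0) ->
  orthogonal_seq u B.
Proof.
move=> Bm Bs B0 Bn0; split=> //; exists (fun n => u ('X^n * B n)) => // m n.
have small (p : {poly R[i]}) k : (size p <= k)%N -> u (p * B k) = 0.
  move=> sp; rewrite -[p]coefK poly_def mulr_suml linear_sum big1 // => i _.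
  by rewrite -scalerAl formZ B0 ?mulr0 // (leq_trans (ltn_ord i)).
have [nm|mn|->] := ltngtP n m.
- by rewrite mulr0 mulrC small // Bs.
- by rewrite mulr0 small // Bs.
rewrite mulr1; apply/eqP; rewrite -subr_eq0 -formB -mulrBl small //.
apply/leq_sizeP => j; rewrite leq_eqVlt => /predU1P[<-|mj].
  have /monicP := Bm m; rewrite lead_coefE Bs /= coefB => ->.
  by rewrite coefXn eqxx subrr.
by rewrite coefB coefXn gtn_eqF // nth_default ?subrr // Bs.
Qed.

(** * The symmetrization of the Alternative q-Charlier form *)

Section SymmetricCharlier.
Variables (R : realType) (q a : R[i]) (u : pform R).
Hypotheses (q0 : q != 0) (q1 : forall n, (0 < n)%N -> q ^+ n != 1).
Hypotheses (a0 : a != 0) (aq0 : forall n, 1 + a * q ^+ n != 0).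
Hypothesis uodd : symmetrical u.
Hypothesis u0 : moment u 0 = 1.
Hypothesis uS :
  forall n, (1 + a * q ^+ n.+1) * moment u n.+1.*2 = moment u n.*2.

Definition gamma_odd n : R[i] :=
  q ^+ n * ((1 + a * q ^+ n) /
    ((1 + a * q ^+ n.*2) * (1 + a * q ^+ n.*2.+1))).

Definition gamma_even n : R[i] :=
  a * q ^+ n.*2.+1 * ((1 - q ^+ n.+1) /
    ((1 + a * q ^+ n.*2.+1) * (1 + a * q ^+ n.*2.+2))).

(** A positive even index m = 2n+2 has n = m/2 - 1; the value at 0 never enters
    the recurrence. *)
Definition charlier_gamma m : R[i] :=
  if odd m then gamma_odd m./2 else gamma_even m./2.-1.

Lemma charlier_gamma_odd n : charlier_gamma n.*2.+1 = gamma_odd n.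
Proof. by rewrite /charlier_gamma /= odd_double uphalf_double. Qed.

Lemma charlier_gamma_even n : charlier_gamma n.*2.+2 = gamma_even n.
Proof. by rewrite /charlier_gamma /= odd_double /= half_double. Qed.

Lemma gamma_odd_cancel n : gamma_odd n * (1 + a * q ^+ n.*2.+1) =
  q ^+ n * ((1 + a * q ^+ n) / (1 + a * q ^+ n.*2)).
Proof.
rewrite /gamma_odd.
have := aq0 n.*2; have := aq0 n.*2.+1.
by move: (1 + a * _) (1 + a * q ^+ n.*2) => x y ? ?; field; apply/andP.
Qed.

Lemma gamma_odd_neq0 n : gamma_odd n != 0.
Proof. by rewrite !mulf_neq0 ?invr_eq0 ?expf_neq0 ?mulf_neq0. Qed.

Lemma gamma_even_neq0 n : gamma_even n != 0.
Proof.
rewrite !mulf_neq0 ?invr_eq0 ?expf_neq0 ?mulf_neq0 //.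
by rewrite subr_eq0 eq_sym q1.
Qed.

Lemma charlier_gamma_neq0 n : charlier_gamma n != 0.
Proof.
by rewrite /charlier_gamma; case: ifP; rewrite ?gamma_odd_neq0 ?gamma_even_neq0.
Qed.

Local Notation B := (monic_rec charlier_gamma).

(** The factor of <u, X^(2j) B_(2n)> and of <u, X^(2j+1) B_(2n+1)> that carries
    the orthogonality: it vanishes exactly for j < n. *)
Definition qdiffs n j : R[i] := \prod_(i < n) (q ^+ j - q ^+ i).

Lemma qdiffsSr n j : qdiffs n.+1 j = qdiffs n j * (q ^+ j - q ^+ n).
Proof. by rewrite /qdiffs big_ord_recr. Qed.

(** The factor i = 0 is split off, and q is extracted from each of the others. *)
Lemma qdiffsSS n j :
  qdiffs n.+1 j.+1 = (q ^+ j.+1 - 1) * q ^+ n * qdiffs n j.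
Proof.
rewrite /qdiffs big_ord_recl expr0 -mulrA; congr (_ * _).
rewrite (eq_bigr (fun i : 'I_n => q * (q ^+ j - q ^+ i))); last first.
  by move=> i _; rewrite mulrBr -!exprS.
by rewrite big_split /= prodr_const card_ord.
Qed.

Lemma qdiffs_eq0 n j : (j < n)%N -> qdiffs n j = 0.
Proof. by move=> jn; rewrite /qdiffs (bigD1 (Ordinal jn)) //= subrr mul0r. Qed.

Lemma qdiffs_neq0 n : qdiffs n n != 0.
Proof.
apply/prodf_neq0 => i _.
have -> : q ^+ n = q ^+ (n - i) * q ^+ i by rewrite -exprD subnK // ltnW.
rewrite -[X in _ - X]mul1r -mulrBl.
by rewrite mulf_neq0 ?expf_neq0 // subr_eq0 q1 // subn_gt0.
Qed.

(** These constants are forced by the recurrence.  In its even step, after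
    division by the common factors, both sides are affine in q^j:
    even_scale (n+1) (q^j - q^n) =
      odd_scale n - gamma_(2n+1) even_scale n (1 + a q^(n+j+1)),
    and comparing coefficients gives even_scale (n+1) and odd_scale n. *)
Definition even_scale n : R[i] :=
  \prod_(i < n) (- (a * q ^+ i.+1 * gamma_odd i)).

Definition odd_scale n : R[i] :=
  even_scale n * (gamma_odd n * (1 + a * q ^+ n.*2.+1)).

Lemma even_scaleS n :
  even_scale n.+1 = even_scale n * - (a * q ^+ n.+1 * gamma_odd n).
Proof. by rewrite /even_scale big_ord_recr. Qed.

Lemma even_scale_neq0 n : even_scale n != 0.
Proof.
apply/prodf_neq0 => i _.
rewrite oppr_eq0 mulf_neq0 ?gamma_odd_neq0 //.
by rewrite mulf_neq0 ?expf_neq0.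
Qed.

Lemma odd_scale_neq0 n : odd_scale n != 0.
Proof. by do 2!rewrite mulf_neq0 ?even_scale_neq0 ?gamma_odd_neq0 //. Qed.

Lemma moment_even_neq0 n : moment u n.*2 != 0.
Proof.
elim: n => [|n IHn]; first by rewrite u0 oner_neq0.
by apply: contra_neq IHn => E; rewrite -uS E mulr0.
Qed.

Lemma u_Xn_monic_recSS n m :
  u ('X^m * B n.+2) = u ('X^(m.+1) * B n.+1) - charlier_gamma n.+1 * u ('X^m * B n).
Proof.
by rewrite monic_recSS mulrBr mulrA -exprSr -scalerAr formB formZ.
Qed.

(** B_n has the parity of n, and u kills odd polynomials. *)
Lemma u_Xn_parity n m : odd (n + m) -> u ('X^m * B n) = 0.
Proof.
have z k : odd k -> u 'X^k = 0.
  by move=> ko; rewrite -[k]odd_double_half ko; apply: uodd.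
suff: (forall m, odd (n + m) -> u ('X^m * B n) = 0) /\
      (forall m, odd (n.+1 + m) -> u ('X^m * B n.+1) = 0) by case=> ? _; auto.
elim: n {m} => [|n [IH IH1]].
  by split=> m om; rewrite /= ?mulr1 -?exprSr z.
split=> // m om.
rewrite u_Xn_monic_recSS IH ?IH1 ?mulr0 ?subr0 // ?addnS //.
by move: om; rewrite /= negbK.
Qed.

(** Induction along the recurrence in n, for all j at once: passing from n to
    n+1 shifts j in the odd step, which is absorbed by [qdiffsSS].  Each step
    reduces to an identity affine in q^j. *)
Lemma u_Xn_closed_form n :
  (forall j, u ('X^(j.*2) * B n.*2)
     = even_scale n * qdiffs n j * moment u (n + j).*2) /\
  (forall j, u ('X^(j.*2.+1) * B n.*2.+1)
     = odd_scale n * qdiffs n j * moment u (n + j).+1.*2).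
Proof.
elim: n => [|n [IHe IHo]].
  split=> j.
    by rewrite /even_scale /qdiffs !big_ord0 !mul1r mulr1.
  rewrite /odd_scale gamma_odd_cancel double0 (divff (aq0 0)).
  by rewrite /even_scale /qdiffs !big_ord0 expr0 !mul1r /= -exprSr.
have even j : u ('X^(j.*2) * B n.+1.*2)
     = even_scale n.+1 * qdiffs n.+1 j * moment u (n.+1 + j).*2.
  rewrite doubleS u_Xn_monic_recSS IHo IHe charlier_gamma_odd.
  rewrite -(uS (n + j)) even_scaleS qdiffsSr /odd_scale addSn.
  rewrite -addnn !exprS !exprD.
  by ring.
split=> // j.
rewrite doubleS u_Xn_monic_recSS -!doubleS even IHo doubleS charlier_gamma_even.
rewrite addnS addSn -(uS (n + j).+1) qdiffsSS qdiffsSr.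
(* What remains after removal of the factor qdiffs n j times the moment. *)
suff E : odd_scale n.+1 * (q ^+ j - q ^+ n) =
    even_scale n.+1 * (q ^+ n * (q ^+ j.+1 - 1))
    - gamma_even n * odd_scale n * (1 + a * q ^+ (n + j).+2).
  by rewrite (mulrC (qdiffs n j)) (mulrA (odd_scale _)) E; ring.
rewrite {1}/odd_scale gamma_odd_cancel even_scaleS /odd_scale /gamma_even.
have := aq0 n.*2.+1; have := aq0 n.*2.+2.
rewrite -addnn doubleS -addnn !exprS !exprD => ? ?.
by field; apply/andP.
Qed.


Lemma u_Xn_monic_rec_lt n m : (m < n)%N -> u ('X^m * B n) = 0.
Proof.
have [mn|] := boolP (odd (n + m)); first by rewrite u_Xn_parity.
rewrite oddD -[n]odd_double_half -[m]odd_double_half.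
rewrite !oddD !odd_double !addbF !oddb.
case: (odd n) (odd m) => [] [] //= _; rewrite ?add0n ?add1n.
- rewrite ltnS ltn_double => mn.
  by rewrite (u_Xn_closed_form _).2 qdiffs_eq0 // mulr0 mul0r.
- rewrite ltn_double => mn.
  by rewrite (u_Xn_closed_form _).1 qdiffs_eq0 // mulr0 mul0r.
Qed.

Lemma u_Xn_monic_rec_neq0 n : u ('X^n * B n) != 0.
Proof.
rewrite -[n]odd_double_half; case: (odd n); rewrite ?add0n ?add1n.
  rewrite (u_Xn_closed_form _).2.
  by do 2!rewrite mulf_neq0 ?odd_scale_neq0 ?qdiffs_neq0 ?moment_even_neq0 //.
rewrite (u_Xn_closed_form _).1.
by do 2!rewrite mulf_neq0 ?even_scale_neq0 ?qdiffs_neq0 ?moment_even_neq0 //.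
Qed.

Lemma monic_rec_orthogonal : orthogonal_seq u B.
Proof.
apply: orthogonal_seq_Xn => [n|n|n m|n].
- exact: (monic_rec_size _ _).1.
- exact: (monic_rec_size _ _).2.
- exact: u_Xn_monic_rec_lt.
- exact: u_Xn_monic_rec_neq0.
Qed.

End SymmetricCharlier.

(** * The class, and the theorem *)

(** H_r X^3 is a multiple of X^2, so at the only zero 0 of X^3 the first modulus
    of the criterion is that of r Psi(0) = r k, hence positive whatever the
    second one is. *)
Lemma semiclassical_X3 (R : realType) (r k b : R[i]) (u : pform R) :
    let Psi := - (k *: (b *: 'X^2 - 1)) in
    r != 0 -> k != 0 -> b != 0 -> r != 1 -> regular u -> pearson r u 'X^3 Psi ->
  semiclassical_of_class r u 1.
Proof.
move=> Psi r0 k0 b0 r1 regu uP; split=> //; exists 'X^3, Psi.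
have sPsi : size Psi = 3.
  rewrite /Psi size_polyN size_scale // size_polyDl size_scale // size_polyXn //.
  by rewrite size_polyN size_poly1.
split; first by split; rewrite ?monicXn ?sPsi.
  rewrite /class_criterion.
  have -> : [set z | root ('X^3 : {poly R[i]}) z]%classic = [set 0]%classic.
    apply/seteqP; split=> z /=; rewrite rootE hornerXn expf_eq0 /=.
      by move/eqP.
    by move=> ->; rewrite eqxx.
  rewrite fsbig_set1 ltr_pwDl // normr_gt0.
  have -> : (Hpoly r 'X^3).[0] = 0.
    have E := Hpoly_Xn 3 r1.
    have -> : Hpoly r 'X^3 = ((r ^+ 3 - 1) / (r - 1)) *: 'X^2.
      by apply: (@mulfI _ 'X); rewrite ?polyX_eq0 // E -scalerAr -exprS.
    by rewrite hornerZ hornerXn expr0n mulr0.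
  rewrite addr0 mulr0 /Psi !hornerE /= mulr0 sub0r mulrN1 opprK.
  by rewrite mulf_neq0.
by rewrite /= sPsi size_polyXn.
Qed.

Theorem mainTheorem5 (R : realType) (q a : R[i]) (A u : pform R)
    (hq : nonroot_of_unity q) (ha0 : a != 0)
    (ha : forall n : nat, a != - (q ^- n))
    (hA : alternative_q_charlier a q A)
    (hu : symmetrical u) (hsigma : sigma u =1 A) :
  let s := principal_sqrt q in
  [/\ semiclassical_of_class s u 1,
      pearson s u 'X^3
        (- ((a * q)^-1 * (s - 1)^-1 *: ((1 + a * q) *: 'X^2 - 1)))
    & exists gamma : nat -> R[i],
        recurrence_coefficients u (fun=> 0) gamma /\
        forall n : nat,
          gamma (n.*2.+1) =
            q ^+ n * ((1 + a * q ^+ n) /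
              ((1 + a * q ^+ n.*2) * (1 + a * q ^+ n.*2.+1))) /\
          gamma (n.*2.+2) =
            a * q ^+ n.*2.+1 * ((1 - q ^+ n.+1) /
              ((1 + a * q ^+ n.*2.+1) * (1 + a * q ^+ n.*2.+2)))].
Proof.
move=> s; have [q0 q1] := hq; have [A0 AP] := hA.
have s2 : s ^+ 2 = q by apply: sqr_sqrtc.
have q1' : q != 1 by rewrite -[q]expr1 q1.
have s0 : s != 0 by apply: contraNneq q0 => s0; rewrite -s2 s0 expr0n.
have s1 : s != 1 by apply: contraNneq q1' => s1; rewrite -s2 s1 expr1n.
have aq0 n : 1 + a * q ^+ n != 0.
  apply: contraNneq (ha n) => /eqP; rewrite addrC addr_eq0 => /eqP E.
  by apply/eqP; rewrite -mulN1r -E mulfK // expf_neq0.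
have aqn : a * q != 0 by rewrite mulf_neq0.
have uA n : moment u n.*2 = moment A n.
  by rewrite /moment -hsigma /= /sigma comp_Xn_poly -exprM mul2n.
have uS n : (1 + a * q ^+ n.+1) * moment u n.+1.*2 = moment u n.*2.
  by rewrite !uA exprS mulrA -addn1; apply: (pearson_moments A 1 aqn q1').1.
have uP : pearson s u 'X^3 (charlier_psi s (a * q) 2).
  apply/pearson_moments=> // n; rewrite addn2.
  rewrite -[n]odd_double_half; case: (odd n); rewrite ?add0n ?add1n.
    by rewrite -doubleS !hu mulr0.
  by rewrite -mul2n exprM s2 -mulrA -exprS mul2n -doubleS uS.
have ortho := monic_rec_orthogonal q0 q1 ha0 aq0 hu (etrans (uA 0) A0) uS.
split; [|exact: uP|].
  apply: (@semiclassical_X3 _ _ ((a * q)^-1 * (s - 1)^-1) (1 + a * q)) => //.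
  - by rewrite mulf_neq0 // invr_eq0 // subr_eq0.
  - by rewrite -[q]expr1 aq0.
  - by exists (monic_rec (charlier_gamma q a)).
exists (charlier_gamma q a); split; last first.
  by move=> n; rewrite charlier_gamma_odd charlier_gamma_even.
split=> [n|]; first exact: charlier_gamma_neq0.
exists (monic_rec (charlier_gamma q a)); split=> // [|n].
  by rewrite /= subr0.
by rewrite subr0.
Qed.
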